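(* Let $n\ge4$ be even. (a) Let $H_1',H_2'$ be subgroups of $\mathcal{MCG}(\mathbb{S}^2,n)$ that are both isomorphic to an amalgamated product of one and the same of the following forms (with the same value of $q$), with the exception of $\mathrm{Dih}_8\ast_{\mathrm{Dih}_4}\mathrm{Dih}_8$: (i) $\mathbb{Z}_{2q}\ast_{\mathbb{Z}_q}\mathbb{Z}_{2q}$, where $q$ divides $(n-i)/2$ for some $i\in\{0,1,2\}$; (ii) $\mathbb{Z}_{2q}\ast_{\mathbb{Z}_q}\mathrm{Dih}_{2q}$, where $q\ge2$ divides $(n-i)/2$ for some $i\in\{0,2\}$; (iii) $\mathrm{Dih}_{2q}\ast_{\mathbb{Z}_q}\mathrm{Dih}_{2q}$, where $q\ge2$ divides $n-i$ strictly for some $i\in\{0,2\}$; (iv) $\mathrm{Dih}_{2q}\ast_{\mathrm{Dih}_q}\mathrm{Dih}_{2q}$, where $q\ge4$ is even and divides $n-i$ for some $i\in\{0,2\}$; (v) $S_4\ast_{A_4}S_4$, where $n\equiv0,2\bmod6$. Then $H_1'\cong H_2'$. (b) Let $H'$ be a subgroup of $\mathcal{MCG}(\mathbb{S}^2,n)$ that is isomorphic to an amalgamated product of the form $\mathrm{Dih}_8\ast_{\mathrm{Dih}_4}\mathrm{Dih}_8$. Then $H'$ is isomorphic to exactly one of the following two groups: $$K_1'=\langle x,y,a,b\mid x^4=y^2=a^4=b^2=1,\ yxy^{-1}=x^{-1},\ bab^{-1}=a^{-1},\ x^2=a^2,\ y=b\rangle,$$ $$K_2'=\langle x,y,a,b\mid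 x^4=y^2=a^4=b^2=1,\ yxy^{-1}=x^{-1},\ bab^{-1}=a^{-1},\ x^2=b,\ y=a^2b\rangle.$$
   Context: $\mathcal{MCG}(\mathbb{S}^2,n)$ is the mapping class group of the $n$-punctured sphere: isotopy classes of orientation-preserving homeomorphisms of $\mathbb{S}^2$ leaving a given $n$-point set invariant. $\mathbb{Z}_m$ is the cyclic group of order $m$, $\mathrm{Dih}_{2m}$ ($m\ge2$) is the dihedral group of order $2m$ (so $\mathrm{Dih}_4\cong\mathbb{Z}_2\oplus\mathbb{Z}_2$), $S_4$ and $A_4$ are the symmetric and alternating groups on four letters. ''Of the form $G_1\ast_FG_2$'' means an amalgamated product with respect to some embeddings of $F$ as an index $2$ subgroup of $G_1$ and of $G_2$. ''Divides strictly'' means divides and is not equal. *)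

(* Defs.v *)
From Stdlib Require List.
From HB Require Import structures.
From mathcomp Require Import all_boot all_order all_algebra all_fingroup.
From mathcomp Require Import all_solvable.
From mathcomp Require Import all_classical reals topology normedtype.
From mathcomp.multinomials Require Import freeg.

Set Implicit Arguments.
Unset Strict Implicit.
Unset Printing Implicit Defensive.

Import Order.TTheory GRing.Theory Num.Theory.
Import numFieldNormedType.Exports.

Local Open Scope classical_set_scope.
Local Open Scope ring_scope.

(* A group whose equality is an equivalence relation weaker than Leibniz
   equality; quot_group is the group of its equivalence classes. *)
Record setoid_group := SetoidGroup {
  sg_sort : Type;
  sg_eqv : sg_sort -> sg_sort -> Prop;
  sg_one : sg_sort;
  sg_inv : sg_sort -> sg_sort;
  sg_mul : sg_sort -> sg_sort -> sg_sort;
  sg_refl : forall x, sg_eqv x x;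
  sg_sym : forall x y, sg_eqv x y -> sg_eqv y x;
  sg_trans : forall x y z, sg_eqv x y -> sg_eqv y z -> sg_eqv x z;
  sg_invP : forall x x', sg_eqv x x' -> sg_eqv (sg_inv x) (sg_inv x');
  sg_mulP : forall x x' y y', sg_eqv x x' -> sg_eqv y y' ->
    sg_eqv (sg_mul x y) (sg_mul x' y');
  sg_mulA : forall x y z,
    sg_eqv (sg_mul x (sg_mul y z)) (sg_mul (sg_mul x y) z);
  sg_mul1 : forall x, sg_eqv (sg_mul sg_one x) x;
  sg_1mul : forall x, sg_eqv (sg_mul x sg_one) x;
  sg_mulV : forall x, sg_eqv (sg_mul (sg_inv x) x) sg_one;
  sg_Vmul : forall x, sg_eqv (sg_mul x (sg_inv x)) sg_one
}.

HB.instance Definition _ S := gen_eqMixin (sg_sort S).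
HB.instance Definition _ S := gen_choiceMixin (sg_sort S).

Section QuotientGroup.
Local Open Scope quotient_scope.
Variable S : setoid_group.

Definition sg_eqb : rel (sg_sort S) := fun x y => `[< sg_eqv x y >].

Fact sg_eqb_refl : reflexive sg_eqb.
Proof. by move=> x; apply/asboolP; exact: sg_refl. Qed.
Fact sg_eqb_sym : symmetric sg_eqb.
Proof. by move=> x y; apply/asboolP/asboolP; exact: sg_sym. Qed.
Fact sg_eqb_trans : transitive sg_eqb.
Proof.
by move=> y x z /asboolP xy /asboolP yz; apply/asboolP; exact: sg_trans xy yz.
Qed.
Canonical sg_equiv := EquivRel sg_eqb sg_eqb_refl sg_eqb_sym sg_eqb_trans.

Definition quot_group := {eq_quot sg_eqb}.
HB.instance Definition _ := Choice.on quot_group.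
HB.instance Definition _ := EqQuotient.on quot_group.

Definition quot_class (x : sg_sort S) : quot_group := \pi_quot_group x.

Lemma quot_classP x y : quot_class x = quot_class y <-> sg_eqv x y.
Proof.
by split=> [/eqquotP /asboolP //|xy]; apply/eqquotP/asboolP.
Qed.

Lemma quot_classK (u : quot_group) : quot_class (generic_quotient.repr u) = u.
Proof. exact: reprK. Qed.

Definition quot_one : quot_group := quot_class (sg_one S).
Definition quot_inv (u : quot_group) : quot_group :=
  quot_class (sg_inv (generic_quotient.repr u)).
Definition quot_mul (u v : quot_group) : quot_group :=
  quot_class (sg_mul (generic_quotient.repr u) (generic_quotient.repr v)).

Lemma quot_invE x : quot_inv (quot_class x) = quot_class (sg_inv x).
Proof. by apply/quot_classP/sg_invP/quot_classP/quot_classK. Qed.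
Lemma quot_mulE x y :
  quot_mul (quot_class x) (quot_class y) = quot_class (sg_mul x y).
Proof. by apply/quot_classP/sg_mulP; apply/quot_classP/quot_classK. Qed.

Fact quot_mulA : associative quot_mul.
Proof.
move=> u v w; rewrite -(quot_classK u) -(quot_classK v) -(quot_classK w).
by rewrite !quot_mulE; apply/quot_classP/sg_mulA.
Qed.
Fact quot_mul1 : left_id quot_one quot_mul.
Proof.
by move=> u; rewrite -(quot_classK u) quot_mulE; apply/quot_classP/sg_mul1.
Qed.
Fact quot_1mul : right_id quot_one quot_mul.
Proof.
by move=> u; rewrite -(quot_classK u) quot_mulE; apply/quot_classP/sg_1mul.
Qed.
Fact quot_mulV : left_inverse quot_one quot_inv quot_mul.
Proof.
move=> u; rewrite -(quot_classK u) quot_invE quot_mulE.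
exact/quot_classP/sg_mulV.
Qed.
Fact quot_Vmul : right_inverse quot_one quot_inv quot_mul.
Proof.
move=> u; rewrite -(quot_classK u) quot_invE quot_mulE.
exact/quot_classP/sg_Vmul.
Qed.

HB.instance Definition _ := isGroup.Build quot_group
  quot_mulA quot_mul1 quot_1mul quot_mulV quot_Vmul.

End QuotientGroup.

Definition isomorphic (G H : groupType) :=
  exists f : {multiplicative G -> H}, bijective f.

Section Presentations.
Variable X : Type.

(* Formal group expressions in the generators X. *)
Inductive word :=
  | wgen of X
  | wone
  | winv of word
  | wmul of word & word.

Definition wexp (w : word) n := iter n (wmul w) wone.

Variable rel : word -> word -> Prop.

(* The congruence generated by the group axioms and the relations of rel. *)
Inductive word_eqv : word -> word -> Prop :=
  | weq_rel u v : rel u v -> word_eqv u v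
  | weq_refl u : word_eqv u u
  | weq_sym u v : word_eqv u v -> word_eqv v u
  | weq_trans u v w : word_eqv u v -> word_eqv v w -> word_eqv u w
  | weq_invP u u' : word_eqv u u' -> word_eqv (winv u) (winv u')
  | weq_mulP u u' v v' : word_eqv u u' -> word_eqv v v' ->
      word_eqv (wmul u v) (wmul u' v')
  | weq_mulA u v w : word_eqv (wmul u (wmul v w)) (wmul (wmul u v) w)
  | weq_mul1 u : word_eqv (wmul wone u) u
  | weq_1mul u : word_eqv (wmul u wone) u
  | weq_mulV u : word_eqv (wmul (winv u) u) wone
  | weq_Vmul u : word_eqv (wmul u (winv u)) wone.

(* The group < X | u = v for all u, v such that rel u v >. *)
Definition presented : groupType := quot_group (SetoidGroup
  weq_refl weq_sym weq_trans weq_invP weq_mulP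
  weq_mulA weq_mul1 weq_1mul weq_mulV weq_Vmul).

End Presentations.

Arguments wone {X}.

Section Amalgams.
Variables (F G1 G2 : groupType) (i1 : F -> G1) (i2 : F -> G2).

Inductive amalgam_rel : word (G1 + G2) -> word (G1 + G2) -> Prop :=
  | amalgam_mul1 x y : amalgam_rel
      (wmul (wgen (inl x)) (wgen (inl y))) (wgen (inl (x * y)%g))
  | amalgam_mul2 x y : amalgam_rel
      (wmul (wgen (inr x)) (wgen (inr y))) (wgen (inr (x * y)%g))
  | amalgam_glue z : amalgam_rel (wgen (inl (i1 z))) (wgen (inr (i2 z))).

Definition amalgam : groupType := presented amalgam_rel.

End Amalgams.

Definition index2_embedding (F G : finGroupType) (i : {morphism [set: F]%SET >-> G}) :=
  ('injm i /\ #|[set: G]%SET : i @* [set: F]%SET| = 2%N)%g.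

Definition of_form (H : groupType) (G1 F G2 : finGroupType) :=
  exists i1 : {morphism [set: F]%SET >-> G1}, exists i2 : {morphism [set: F]%SET >-> G2},
    [/\ index2_embedding i1, index2_embedding i2 & isomorphic H (amalgam i1 i2)].

(* The group law of 'I_m.-1.+1 is addition modulo m, for m > 0. *)
Definition cyclic_group (m : nat) : finGroupType := 'I_m.-1.+1.

(* 'D_m is the dihedral group of order m, for m even, m >= 4. *)
Definition dihedral_group (m : nat) : finGroupType := 'D_m.
Definition S4 : finGroupType := 'S_4.
Definition A4 : finGroupType := [subg 'Alt_('I_4)].

Inductive amalgam_form :=
  | CyclicCyclic of nat
  | CyclicDihedral of nat
  | DihedralCyclicDihedral of nat
  | DihedralDihedralDihedral of nat
  | SymAltSym.

Definition has_form (H : groupType) (f : amalgam_form) : Prop :=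
  match f with
  | CyclicCyclic q =>
      of_form H (cyclic_group (2 * q)) (cyclic_group q) (cyclic_group (2 * q))
  | CyclicDihedral q =>
      of_form H (cyclic_group (2 * q)) (cyclic_group q) (dihedral_group (2 * q))
  | DihedralCyclicDihedral q =>
      of_form H (dihedral_group (2 * q)) (cyclic_group q) (dihedral_group (2 * q))
  | DihedralDihedralDihedral q =>
      of_form H (dihedral_group (2 * q)) (dihedral_group q)
        (dihedral_group (2 * q))
  | SymAltSym => of_form H S4 A4 S4
  end.

(* q divides m / 2, where m / 2 has to be an integer. *)
Definition divides_half (q m : nat) := (2 %| m)%N && (q %| m %/ 2)%N.

Definition admissible (n : nat) (f : amalgam_form) : Prop :=
  match f with
  | CyclicCyclic q => exists2 i, i \in [:: 0; 1; 2]%N & divides_half q (n - i)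
  | CyclicDihedral q =>
      (2 <= q)%N /\ exists2 i, i \in [:: 0; 2]%N & divides_half q (n - i)
  | DihedralCyclicDihedral q =>
      (2 <= q)%N /\
      exists2 i, i \in [:: 0; 2]%N & (q %| n - i)%N && (q != n - i)%N
  | DihedralDihedralDihedral q =>
      [/\ (4 <= q)%N, ~~ odd q & exists2 i, i \in [:: 0; 2]%N & (q %| n - i)%N]
  | SymAltSym => (n = 0 %[mod 6])%N \/ (n = 2 %[mod 6])%N
  end.

Section K1K2.

Inductive gen4 := gen_x | gen_y | gen_a | gen_b.

Let x := wgen gen_x.
Let y := wgen gen_y.
Let a := wgen gen_a.
Let b := wgen gen_b.
Local Infix "**" := wmul (at level 40, left associativity).
Local Infix "^^" := wexp (at level 30).

Definition K_common : seq (word gen4 * word gen4) :=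
  [:: (x ^^ 4, wone); (y ^^ 2, wone); (a ^^ 4, wone); (b ^^ 2, wone);
      (y ** x ** winv y, winv x); (b ** a ** winv b, winv a)].

Definition K1_rels := K_common ++ [:: (x ^^ 2, a ^^ 2); (y, b)].
Definition K2_rels := K_common ++ [:: (x ^^ 2, b); (y, a ^^ 2 ** b)].

Definition K1 : groupType := presented (fun u v => List.In (u, v) K1_rels).
Definition K2 : groupType := presented (fun u v => List.In (u, v) K2_rels).

End K1K2.

Section Spheres.
Variable R : realType.

Definition sphere_set : set 'rV[R]_3 := [set x | \sum_(i < 3) x 0 i ^+ 2 = 1].
Definition sphere : topologicalType := set_type sphere_set.

Definition unit_itv_set : set R := [set t | 0 <= t <= 1].
Definition unit_itv : topologicalType := set_type unit_itv_set.

Fact itv0_subproof : (0 : R) \in unit_itv_set.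
Proof. by rewrite inE /unit_itv_set /= lexx ler01. Qed.
Fact itv1_subproof : (1 : R) \in unit_itv_set.
Proof. by rewrite inE /unit_itv_set /= lexx ler01. Qed.
Definition itv0 : unit_itv := exist _ 0 itv0_subproof.
Definition itv1 : unit_itv := exist _ 1 itv1_subproof.

Fact itv_rev_subproof (t : unit_itv) : (1 - \val t) \in unit_itv_set.
Proof.
case: t => t /=; rewrite !inE /unit_itv_set /= => /andP[t0 t1].
by rewrite subr_ge0 t1 /= lerBlDr lerDl.
Qed.
Definition itv_rev (t : unit_itv) : unit_itv := 
  exist (fun t => t \in unit_itv_set) _ (itv_rev_subproof t).

Lemma itv_rev_continuous : continuous itv_rev.
Proof.
apply: continuous_comp_initial => t.
apply: (@continuous_comp _ _ _ (fun t : unit_itv => \val t : R)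
  (fun x : R => 1 - x)).
  exact: initial_continuous.
apply: cvgB; [exact: cvg_cst|exact: cvg_id].
Qed.

Lemma itv_rev0 : itv_rev itv0 = itv1.
Proof. by apply: val_inj; rewrite /= subr0. Qed.
Lemma itv_rev1 : itv_rev itv1 = itv0.
Proof. by apply: val_inj; rewrite /= subrr. Qed.

Definition std_simplex_set k : set 'rV[R]_k.+1 :=
  [set x | (forall i, 0 <= x 0 i) /\ \sum_i x 0 i = 1].
Definition std_simplex k : topologicalType := set_type (@std_simplex_set k).

Definition insert0 k (i : 'I_k.+2) (x : 'rV[R]_k.+1) : 'rV[R]_k.+2 :=
  \row_j oapp (x 0) 0 (unlift i j).

Fact face_subproof k (i : 'I_k.+2) (x : std_simplex k) :
  insert0 i (\val x) \in @std_simplex_set k.+1.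
Proof.
case: x => x /=; rewrite !inE /std_simplex_set /= => -[x0 x1]; split.
  by move=> j; rewrite mxE; case: (unliftP i j) => [l|] _ /=.
rewrite (bigD1_ord i) //= mxE unlift_none /= add0r -[RHS]x1.
by apply: eq_bigr => j _; rewrite mxE liftK.
Qed.
Definition face k (i : 'I_k.+2) (x : std_simplex k) : std_simplex k.+1 :=
  exist (fun y => y \in @std_simplex_set k.+1) _ (face_subproof i x).

Lemma face_continuous k (i : 'I_k.+2) : continuous (face i).
Proof.
apply: continuous_comp_initial => x.
suff: continuous (fun y : std_simplex k => insert0 i (\val y)) by apply.
move=> {x} x A [P xP PA].
have val_cont : continuous (fun y : std_simplex k => \val y : 'rV[R]_k.+1).
  exact: initial_continuous.
have H (j : 'I_k.+2) : \forall y \near x, P 0 j (insert0 i (\val y) 0 j).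
  have := xP 0 j; rewrite /= mxE; case: (unliftP i j) => [l|] -> /= nP.
    have c : continuous (fun y : std_simplex k => (\val y : 'rV[R]_k.+1) 0 l).
      move=> y; apply: (@continuous_comp _ _ _ _ (fun M : 'rV[R]_k.+1 => M 0 l)).
        exact: val_cont.
      exact: coord_continuous.
    have : \forall y \near x, P 0 (fintype.lift i l) ((\val y : 'rV[R]_k.+1) 0 l).
      exact: (c x _ nP).
    apply: filterS => y /= Py.
    by rewrite mxE liftK.
  apply: filterE => y; rewrite mxE unlift_none /=.
  exact: nbhs_singleton nP.
have Hall : \forall y \near x, forall j : 'I_k.+2,
    P 0 j (insert0 i (\val y) 0 j) 
  by exact: (@filter_forall _ _ _ (nbhs x) _ H).
suff: nbhs x ((fun y : std_simplex k => insert0 i (\val y)) @^-1` A) by [].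
apply: filterS Hall => y Py.
by apply: PA => a b; rewrite !ord1.
Qed.

HB.instance Definition _ k (i : 'I_k.+2) :=
  @isContinuous.Build (std_simplex k) (std_simplex k.+1) (face i)
    (@face_continuous k i).

End Spheres.

Section SingularHomology.
Variable R : realType.
Implicit Types X Y : topologicalType.

Definition singular X k := continuousType (std_simplex R k) X.
HB.instance Definition _ X k := Choice.on (singular X k).

Definition chain X k := {freeg (singular X k) / int}.
HB.instance Definition _ X k := GRing.Lmodule.on (chain X k).

Definition chain1 X k (sigma : singular X k) : chain X k := << sigma >>.

Definition simplex_face X k (sigma : singular X k.+1) (i : 'I_k.+2) :
  singular X k := sigma \o face i.

Definition simplex_push X Y (f : continuousType X Y) k (sigma : singular X k) :
  singular Y k := f \o sigma.

Definition boundary X k : chain X k.+1 -> chain X k :=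
  fglift (fun sigma : singular X k.+1 =>
    \sum_(i < k.+2) (-1) ^+ i *: chain1 (simplex_face sigma i)).

Definition pushforward X Y (f : continuousType X Y) k : chain X k -> chain Y k :=
  fglift (fun sigma : singular X k => chain1 (simplex_push f sigma)).

(* f acts as the identity on the singular homology group H_(k+1)(X; Z). *)
Definition homology_trivial X k (f : continuousType X X) :=
  forall z : chain X k.+1, boundary z = 0 ->
    exists w : chain X k.+2, boundary w = pushforward f z - z.

Fact boundary_is_additive X k : additive (@boundary X k).
Proof. exact: lift_is_additive. Qed.
HB.instance Definition _ X k :=
  GRing.isAdditive.Build (chain X k.+1) (chain X k) (@boundary X k)
    (@boundary_is_additive X k).

Fact pushforward_is_additive X Y f k : additive (@pushforward X Y f k).
Proof. exact: lift_is_additive. Qed.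
HB.instance Definition _ X Y f k :=
  GRing.isAdditive.Build (chain X k) (chain Y k) (@pushforward X Y f k)
    (@pushforward_is_additive X Y f k).

Lemma chain_ext X k (M : zmodType) (g h : {additive chain X k -> M}) :
  (forall sigma, g (chain1 sigma) = h (chain1 sigma)) -> g =1 h.
Proof.
move=> gh z; rewrite -(freeg_sumE z) !raddf_sum; apply: eq_bigr => s _.
have -> : << coeff s z *g s >> = chain1 s *~ coeff s z.
  by rewrite /chain1 freegU_mulz intz.
by rewrite !raddfMz gh.
Qed.

Lemma boundary1 X k (sigma : singular X k.+1) :
  boundary (chain1 sigma) =
  \sum_(i < k.+2) (-1) ^+ i *: chain1 (simplex_face sigma i).
Proof. by rewrite /boundary /chain1 liftU scale1r. Qed.

Lemma pushforward1 X Y (f : continuousType X Y) k (sigma : singular X k) :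
  pushforward f (chain1 sigma) = chain1 (simplex_push f sigma).
Proof. by rewrite /pushforward /chain1 liftU scale1r. Qed.

Lemma pushforward_boundary X Y (f : continuousType X Y) k (z : chain X k.+1) :
  boundary (pushforward f z) = pushforward f (boundary z).
Proof.
have := @chain_ext _ _ _ (@boundary Y k \o @pushforward X Y f k.+1)
  (@pushforward X Y f k \o @boundary X k).
apply => sigma /=.
rewrite pushforward1 !boundary1 raddf_sum; apply: eq_bigr => i _.
have -> : simplex_face (simplex_push f sigma) i =
          simplex_push f (simplex_face sigma i) by apply/continuousEP.
rewrite -signr_odd; case: (odd i); rewrite ?expr1 ?expr0 ?scale1r ?scaleN1r.
  by rewrite raddfN /= pushforward1.
by rewrite /= pushforward1.
Qed.

Lemma pushforward_comp X (f g : continuousType X X) k (z : chain X k) :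
  pushforward (g \o f) z = pushforward g (pushforward f z).
Proof.
have := @chain_ext _ _ _ (@pushforward X X (g \o f) k)
  (@pushforward X X g k \o @pushforward X X f k).
apply => sigma /=; rewrite !pushforward1.
by congr chain1; apply/continuousEP.
Qed.

Lemma pushforward_id X k (z : chain X k) : pushforward idfun z = z.
Proof.
have := @chain_ext _ _ _ (@pushforward X X idfun k) idfun.
apply => sigma /=; rewrite pushforward1.
by congr chain1; apply/continuousEP.
Qed.

Lemma homology_trivial_id X k : homology_trivial k (idfun : continuousType X X).
Proof. by move=> z _; exists 0; rewrite raddf0 pushforward_id subrr. Qed.

Lemma homology_trivial_comp X k (f g : continuousType X X) :
  homology_trivial k f -> homology_trivial k g ->
  homology_trivial k (g \o f : continuousType X X).
Proof.
move=> hf hg z z0; have [w wE] := hf z z0.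
have [|w' w'E] := hg (pushforward f z).
  by rewrite pushforward_boundary z0 raddf0.
exists (w' + w); rewrite raddfD /= wE w'E pushforward_comp.
by rewrite addrA subrK.
Qed.

Lemma homology_trivial_inv X k (f g : continuousType X X) :
  cancel f g -> homology_trivial k f -> homology_trivial k g.
Proof.
move=> fK hf z z0; have [w wE] := hf z z0.
exists (- pushforward g w); rewrite raddfN /= pushforward_boundary wE.
rewrite raddfB /= -pushforward_comp opprB; congr (_ - _).
rewrite -[RHS](pushforward_id z); congr (@pushforward _ _ _ _ z).
by apply/continuousEP => x /=; rewrite fK.
Qed.

End SingularHomology.

Lemma continuous_pair (T U V : topologicalType) (f : T -> U) (g : T -> V) x :
  {for x, continuous f} -> {for x, continuous g} ->
  {for x, continuous (fun y => (f y, g y))}.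
Proof. by move=> cf cg; exact: (cvg_pair cf cg). Qed.

Section MappingClassGroup.
Variables (R : realType) (P : set (sphere R)).

Notation S2 := (sphere R).

(* H_2(S^2; Z) is infinite cyclic, so that a homeomorphism of S^2 acts on it by
   1 or -1, and preserves the orientation exactly when it acts by 1. *)
Definition orientation_preserving (f : continuousType S2 S2) :=
  homology_trivial R 1 f.

Record homeo := Homeo {
  homeo_fun :> continuousType S2 S2;
  homeo_inv : continuousType S2 S2;
  homeoK : cancel homeo_fun homeo_inv;
  homeoVK : cancel homeo_inv homeo_fun;
  homeo_stable : homeo_fun @` P = P;
  homeo_orientation : orientation_preserving homeo_fun
}.

HB.instance Definition _ := gen_eqMixin homeo.
HB.instance Definition _ := gen_choiceMixin homeo.

Lemma homeoP (f g : homeo) : f =1 g -> f = g.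
Proof.
move=> fg; have fgi : homeo_inv f = homeo_inv g.
  by apply/continuousEP => x; rewrite -{1}(homeoVK g x) -fg homeoK.
have {fg} : homeo_fun f = homeo_fun g by apply/continuousEP.
case: f fgi => f f' f1 f2 f3 f4; case: g => g g' g1 g2 g3 g4 /= fgi fg.
subst g g'; congr Homeo; exact: Prop_irrelevance.
Qed.

Definition homeo_one : homeo.
Proof.
apply: (@Homeo idfun idfun) => //; first by rewrite image_id.
exact: homology_trivial_id.
Defined.

Definition homeo_mul (f g : homeo) : homeo.
Proof.
apply: (@Homeo (f \o g) (homeo_inv g \o homeo_inv f)).
- by move=> x /=; rewrite !homeoK.
- by move=> x /=; rewrite !homeoVK.
- by rewrite -image_comp !homeo_stable.
- by apply: homology_trivial_comp; apply: homeo_orientation.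
Defined.

Definition homeo_invg (f : homeo) : homeo.
Proof.
apply: (@Homeo (homeo_inv f) f (homeoVK f) (homeoK f)).
- rewrite -[in LHS](homeo_stable f) image_comp -[RHS]image_id.
  by congr (_ @` _); apply/funext => x /=; rewrite homeoK.
- exact: homology_trivial_inv (homeoK f) (homeo_orientation f).
Defined.

Fact homeo_mulA : associative homeo_mul.
Proof. by move=> f g h; apply: homeoP. Qed.
Fact homeo_mul1 : left_id homeo_one homeo_mul.
Proof. by move=> f; apply: homeoP. Qed.
Fact homeo_1mul : right_id homeo_one homeo_mul.
Proof. by move=> f; apply: homeoP. Qed.
Fact homeo_mulV : left_inverse homeo_one homeo_invg homeo_mul.
Proof. by move=> f; apply: homeoP => x /=; rewrite homeoK. Qed.
Fact homeo_Vmul : right_inverse homeo_one homeo_invg homeo_mul.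
Proof. by move=> f; apply: homeoP => x /=; rewrite homeoVK. Qed.

HB.instance Definition _ := isGroup.Build homeo
  homeo_mulA homeo_mul1 homeo_1mul homeo_mulV homeo_Vmul.

(* Every stage F t is a homeo, so it leaves P invariant. *)
Definition isotopic (f g : homeo) :=
  exists F : unit_itv R -> homeo,
    [/\ continuous (fun tx : unit_itv R * S2 => F tx.1 tx.2),
        F (itv0 R) = f & F (itv1 R) = g].

Lemma isotopic_refl f : isotopic f f.
Proof.
exists (fun=> f); split=> // -[t x].
apply: (@continuous_comp _ _ _ snd f); first exact: cvg_snd.
exact: cts_fun.
Qed.

Lemma isotopic_sym f g : isotopic f g -> isotopic g f.
Proof.
move=> [F [cF F0 F1]]; exists (F \o @itv_rev R); split.
- move=> [t x].
  apply: (@continuous_comp _ _ _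
    (fun tx : unit_itv R * S2 => (itv_rev tx.1, tx.2))
    (fun tx : unit_itv R * S2 => F tx.1 tx.2)); last exact: cF.
  apply: continuous_pair; last exact: cvg_snd.
  apply: (@continuous_comp _ _ _ fst (@itv_rev R)); first exact: cvg_fst.
  exact: itv_rev_continuous.
- by rewrite /= itv_rev0.
- by rewrite /= itv_rev1.
Qed.

Lemma isotopic_mul f f' g g' :
  isotopic f f' -> isotopic g g' -> isotopic (f * g)%g (f' * g')%g.
Proof.
move=> [F [cF F0 F1]] [G [cG G0 G1]].
exists (fun t => F t * G t)%g; split; last 2 first.
- by rewrite F0 G0.
- by rewrite F1 G1.
move=> [t x].
apply: (@continuous_comp _ _ _
  (fun tx : unit_itv R * S2 => (tx.1, G tx.1 tx.2))
  (fun tx : unit_itv R * S2 => F tx.1 tx.2)); last exact: cF.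
by apply: continuous_pair; [exact: cvg_fst|exact: cG].
Qed.

Lemma isotopic_trans f g h : isotopic f g -> isotopic g h -> isotopic f h.
Proof.
move=> fg gh; have := isotopic_mul (isotopic_mul fg (isotopic_refl g^-1%g)) gh.
by rewrite mulgVK mulgV mul1g.
Qed.

Lemma isotopic_inv f g : isotopic f g -> isotopic f^-1%g g^-1%g.
Proof.
move=> /isotopic_sym gf; have := isotopic_mul
  (isotopic_mul (isotopic_refl f^-1%g) gf) (isotopic_refl g^-1%g).
by rewrite mulgK mulVg mul1g.
Qed.

Lemma isotopic_eq f g : f = g -> isotopic f g.
Proof. by move=> ->; exact: isotopic_refl. Qed.

(* For a set P of n points this is MCG(S^2, n); the product of the classes of
   f and g is the class of f \o g. *)
Definition mcg : groupType := quot_group (SetoidGroup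
  isotopic_refl isotopic_sym isotopic_trans isotopic_inv isotopic_mul
  (fun f g h => isotopic_eq (mulgA f g h))
  (fun f => isotopic_eq (mul1g f)) (fun f => isotopic_eq (mulg1 f))
  (fun f => isotopic_eq (mulVg f)) (fun f => isotopic_eq (mulgV f))).

End MappingClassGroup.

(* Main.v *)
Require Import Defs.
From HB Require Import structures.
From mathcomp Require Import all_boot all_order all_algebra all_fingroup.
From mathcomp Require Import all_solvable.
From mathcomp Require Import boolp.

(** Up to isomorphism, an amalgam of G1 and G2 over F depends on the two
    embeddings of F only up to automorphisms of the factors: an automorphism of
    each factor carrying one embedding to another induces an isomorphism of the
    amalgams ([isomorphic_amalgam]). So uniqueness for a given form follows as
    soon as, for each factor G, any two embeddings of F as a subgroup of index 2
    differ by an automorphism of G ([unique_embedding], [of_form_unique]).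

    This holds for every pair (F, G) of the list except one.
    - Z_q in Z_2q: the image of a generator of Z_q is the square of a generator
      of Z_2q, since a unit modulo q lifts to an odd unit ([cycle_sqrt]); two
      generators of Z_2q correspond under an automorphism.
    - Z_q in Dih_2q: the image u of a generator of Z_q is the rotation of some
      generating pair (rotation, reflection), and any two such pairs correspond
      under an automorphism ([dihedral_automorphism]).
    - Dih_2p in Dih_4p with p at least 3: elements of order at least 3 are
      rotations, so the generating rotation of Dih_2p goes to a rotation, which
      has a square root generating all rotations, and a reflection goes to a
      reflection. The square root and the reflection form a generating pair of
      Dih_4p that determines the embedding.
    - A4 in S4: both embeddings make A4 act transitively on four points, with
      stabilizers of order 3. These are Sylow subgroups, hence conjugate, so the
      two actions are isomorphic and the embeddings differ by an inner
      automorphism of S4.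

    For Dih_4 in Dih_8 the third argument breaks down: Dih_4 is a Klein
    four-group, and any one of its three involutions can be mapped to the
    central rotation of Dih_8. This choice is the only invariant of the
    embedding ([klein_embedding]), and an amalgam sees whether the two
    embeddings make the same choice. If they do, the amalgam has the
    presentation K1, otherwise the presentation K2 ([amalgam_dihedral8]).
    Finally K1 maps onto an elementary abelian group of order 8, whereas in an
    elementary abelian 2-group the images of the generators b = x^2 and
    y = a^2 b of K2 are trivial, so that an image of K2 has order at most 4
    ([K1_not_K2]). *)

Set Implicit Arguments.
Unset Strict Implicit.
Unset Printing Implicit Defensive.

Local Open Scope group_scope.

(** * Homomorphisms and isomorphisms *)

Section Homomorphisms.
Variables (G H : groupType) (f : G -> H).
Hypothesis fM : {morph f : x y / x * y}.

Lemma hom1 : f 1 = 1.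
Proof. by apply: (@mulgI _ (f 1)); rewrite -fM !mulg1. Qed.

Lemma homV x : f x^-1 = (f x)^-1.
Proof. by apply: (@mulgI _ (f x)); rewrite -fM !mulgV hom1. Qed.

Lemma homX n x : f (x ^+ n) = f x ^+ n.
Proof. by elim: n => [|n IHn]; rewrite ?expg0 ?hom1 // !expgS fM IHn. Qed.

End Homomorphisms.

Lemma exponent2_commute (G : groupType) :
  (forall x : G, x ^+ 2 = 1) -> forall x y : G, x * y = y * x.
Proof.
move=> sqr x y; have V u : u^-1 = u :> G.
  by apply: (@mulgI _ u); rewrite mulgV -expg2 sqr.
by rewrite -[LHS]V invgM !V.
Qed.

Lemma isomorphicI (G H : groupType) (f : G -> H) (g : H -> G) :
  {morph f : x y / x * y} -> cancel f g -> cancel g f -> isomorphic G H.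
Proof.
move=> fM fK gK.
pose m := isMultiplicative.Build G H f fM.
pose f' : {multiplicative G -> H} := HB.pack f m.
by exists f'; exists g.
Qed.

Lemma isomorphic_sym (G H : groupType) : isomorphic G H -> isomorphic H G.
Proof.
move=> [f [g fK gK]]; apply: (@isomorphicI _ _ g f) => //.
exact: (can2_gmulfM fK gK).
Qed.

Lemma isomorphic_trans (G H K : groupType) :
  isomorphic G H -> isomorphic H K -> isomorphic G K.
Proof.
move=> [f [f' fK f'K]] [g [g' gK g'K]].
apply: (@isomorphicI _ _ (g \o f) (f' \o g')).
- by move=> x y; rewrite /= !gmulfM.
- by move=> x; rewrite /= gK fK.
- by move=> x; rewrite /= f'K g'K.
Qed.

(** * Presented groups and amalgams *)

Section PresentedGroups.
Variables (X : Type) (rel : word X -> word X -> Prop).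
Local Notation P := (presented rel).

(** The quotient of this setoid is [presented rel] by definition, but the
    setoid cannot be inferred from the type of words. *)
Definition word_setoid : setoid_group := SetoidGroup
  (@weq_refl X rel) (@weq_sym X rel) (@weq_trans X rel) (@weq_invP X rel)
  (@weq_mulP X rel) (@weq_mulA X rel) (@weq_mul1 X rel) (@weq_1mul X rel)
  (@weq_mulV X rel) (@weq_Vmul X rel).

Definition pclass (w : word X) : P := @quot_class word_setoid w.
Definition pgen (x : X) : P := pclass (wgen x).

Lemma pclassM u v : pclass (wmul u v) = pclass u * pclass v.
Proof. by rewrite /pclass -quot_mulE. Qed.

Lemma pclass_ind (Q : P -> Prop) : (forall w, Q (pclass w)) -> forall u, Q u.
Proof. by move=> Qw u; rewrite -[u]quot_classK; apply: Qw. Qed.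

Lemma pclass_rel u v : rel u v -> pclass u = pclass v.
Proof. by move=> uv; apply/quot_classP/weq_rel. Qed.

Fixpoint word_eval (H : groupType) (f : X -> H) (w : word X) : H :=
  match w with
  | wgen x => f x
  | wone => 1
  | winv u => (word_eval f u)^-1
  | wmul u v => word_eval f u * word_eval f v
  end.

Lemma word_evalX (H : groupType) (f : X -> H) w n :
  word_eval f (wexp w n) = word_eval f w ^+ n.
Proof.
by elim: n => //= n IHn; rewrite expgS -IHn.
Qed.

Lemma word_eval_hom (H : groupType) (f : P -> H) w :
  {morph f : x y / x * y} -> f (pclass w) = word_eval (f \o pgen) w.
Proof.
move=> fM; elim: w => //= [|u <-|u <- v <-]; first exact: (hom1 fM).
  by rewrite -homV // /pclass -quot_invE.
by rewrite pclassM fM.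
Qed.

Lemma word_eval_pgen w : word_eval pgen w = pclass w.
Proof. exact/esym/(@word_eval_hom _ id). Qed.

Lemma pgen_rel u v : rel u v -> word_eval pgen u = word_eval pgen v.
Proof. by move=> uv; rewrite !word_eval_pgen; apply: pclass_rel. Qed.

Lemma presented_hom_ext (H : groupType) (f g : P -> H) :
  {morph f : x y / x * y} -> {morph g : x y / x * y} ->
  (forall x, f (pgen x) = g (pgen x)) -> f =1 g.
Proof.
move=> fM gM fg; apply: pclass_ind => w; rewrite !word_eval_hom //.
by congr word_eval; apply/funext.
Qed.

Definition presented_lift (H : groupType) (f : X -> H) (u : P) : H :=
  word_eval f (generic_quotient.repr u).

Section Lift.
Variables (H : groupType) (f : X -> H).
Hypothesis f_rel : forall u v, rel u v -> word_eval f u = word_eval f v.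

Lemma word_eval_eqv u v : word_eqv rel u v -> word_eval f u = word_eval f v.
Proof.
elim=> //= {u v}.
- by move=> u v w _ -> _ ->.
- by move=> u u' _ ->.
- by move=> u u' v v' _ -> _ ->.
- by move=> u v w; rewrite mulgA.
- by move=> u; rewrite mul1g.
- by move=> u; rewrite mulg1.
- by move=> u; rewrite mulVg.
- by move=> u; rewrite mulgV.
Qed.

Lemma presented_liftE w : presented_lift f (pclass w) = word_eval f w.
Proof.
apply/word_eval_eqv; apply/(quot_classP (S := word_setoid) _ _).1.
exact: quot_classK.
Qed.

Lemma presented_liftM : {morph presented_lift f : x y / x * y}.
Proof.
apply: pclass_ind => u; apply: pclass_ind => v.
by rewrite -pclassM !presented_liftE.
Qed.

Lemma presented_lift_gen x : presented_lift f (pgen x) = f x.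
Proof. exact: presented_liftE. Qed.

End Lift.
End PresentedGroups.

Lemma word_eval_closed (X : Type) (gT : finGroupType) (f : X -> gT)
    (L : {group gT}) w : (forall x, f x \in L) -> word_eval f w \in L.
Proof.
move=> fL; elim: w => //= [u Lu|u Lu v Lv].
  by rewrite groupV.
by rewrite groupM.
Qed.

Section AmalgamMaps.
Variables (F G1 G2 : groupType) (i1 : F -> G1) (i2 : F -> G2).
Local Notation A := (amalgam i1 i2).

Definition amalgam_inl (x : G1) : A := pgen (amalgam_rel i1 i2) (inl x).
Definition amalgam_inr (x : G2) : A := pgen (amalgam_rel i1 i2) (inr x).

Lemma amalgam_inlM : {morph amalgam_inl : x y / x * y}.
Proof.
move=> x y; rewrite /amalgam_inl /pgen -pclassM.
exact/esym/pclass_rel/amalgam_mul1.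
Qed.

Lemma amalgam_inrM : {morph amalgam_inr : x y / x * y}.
Proof.
move=> x y; rewrite /amalgam_inr /pgen -pclassM.
exact/esym/pclass_rel/amalgam_mul2.
Qed.

Lemma amalgam_glueE z : amalgam_inl (i1 z) = amalgam_inr (i2 z).
Proof. exact/pclass_rel/amalgam_glue. Qed.

Lemma amalgam_hom_ext (H : groupType) (f g : A -> H) :
  {morph f : x y / x * y} -> {morph g : x y / x * y} ->
  (forall x, f (amalgam_inl x) = g (amalgam_inl x)) ->
  (forall x, f (amalgam_inr x) = g (amalgam_inr x)) -> f =1 g.
Proof.
move=> fM gM fg1 fg2; apply: presented_hom_ext => // -[x|x]; first exact: fg1.
exact: fg2.
Qed.

Lemma amalgam_lift (H : groupType) (f1 : G1 -> H) (f2 : G2 -> H) :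
    {morph f1 : x y / x * y} -> {morph f2 : x y / x * y} ->
    (forall z, f1 (i1 z) = f2 (i2 z)) ->
  exists f : A -> H, [/\ {morph f : x y / x * y},
    forall x, f (amalgam_inl x) = f1 x & forall x, f (amalgam_inr x) = f2 x].
Proof.
move=> f1M f2M f12; pose f s := match s with inl x => f1 x | inr x => f2 x end.
have f_rel u v : amalgam_rel i1 i2 u v -> word_eval f u = word_eval f v.
  by case=> [x y|x y|z] /=; rewrite ?f1M ?f2M.
exists (presented_lift f); split; first exact: presented_liftM.
  by move=> x; apply: (presented_lift_gen f_rel).
by move=> x; apply: (presented_lift_gen f_rel).
Qed.

End AmalgamMaps.

Lemma isomorphic_amalgam (F G1 G2 : groupType)
    (i1 j1 : F -> G1) (i2 j2 : F -> G2) (a1 : G1 -> G1) (a2 : G2 -> G2) :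
    {morph a1 : x y / x * y} -> bijective a1 -> a1 \o i1 =1 j1 ->
    {morph a2 : x y / x * y} -> bijective a2 -> a2 \o i2 =1 j2 ->
  isomorphic (amalgam i1 i2) (amalgam j1 j2).
Proof.
move=> a1M [b1 a1K b1K] ij1 a2M [b2 a2K b2K] ij2.
have inlM := amalgam_inlM; have inrM := amalgam_inrM.
have b1M : {morph b1 : x y / x * y}.
  by move=> x y; apply: (can_inj a1K); rewrite a1M !b1K.
have b2M : {morph b2 : x y / x * y}.
  by move=> x y; apply: (can_inj a2K); rewrite a2M !b2K.
have [|||f [fM f1 f2]] := @amalgam_lift _ _ _ i1 i2 (amalgam j1 j2)
    (amalgam_inl j1 j2 \o a1) (amalgam_inr j1 j2 \o a2).
- by move=> x y /=; rewrite a1M inlM.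
- by move=> x y /=; rewrite a2M inrM.
- by move=> z /=; rewrite (ij1 z : a1 _ = _) (ij2 z : a2 _ = _) amalgam_glueE.
have [|||g [gM g1 g2]] := @amalgam_lift _ _ _ j1 j2 (amalgam i1 i2)
    (amalgam_inl i1 i2 \o b1) (amalgam_inr i1 i2 \o b2).
- by move=> x y /=; rewrite b1M inlM.
- by move=> x y /=; rewrite b2M inrM.
- by move=> z; rewrite -ij1 -ij2 /= a1K a2K amalgam_glueE.
apply: (@isomorphicI _ _ f g) => //.
- apply: amalgam_hom_ext => //.
  + by move=> x y; rewrite fM gM.
  + by move=> x; rewrite /= f1 /= g1 /= a1K.
  + by move=> x; rewrite /= f2 /= g2 /= a2K.
- apply: amalgam_hom_ext => //.
  + by move=> x y; rewrite gM fM.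
  + by move=> x; rewrite /= g1 /= f1 /= b1K.
  + by move=> x; rewrite /= g2 /= f2 /= b2K.
Qed.

(** * Reduction to uniqueness of embeddings *)

Definition embeddings_equivalent (F G : finGroupType)
    (i j : {morphism [set: F] >-> G}) :=
  exists a : G -> G, [/\ {morph a : x y / x * y}, bijective a & a \o i =1 j].

Definition unique_embedding (F G : finGroupType) :=
  forall i j : {morphism [set: F] >-> G},
  index2_embedding i -> index2_embedding j -> embeddings_equivalent i j.

Lemma of_form_unique (H H' : groupType) (F G1 G2 : finGroupType) :
    unique_embedding F G1 -> unique_embedding F G2 ->
  of_form H G1 F G2 -> of_form H' G1 F G2 -> isomorphic H H'.
Proof.
move=> u1 u2 [i1 [i2 [ii1 ii2 isoH]]] [j1 [j2 [ij1 ij2 isoH']]].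
have [a1 [a1M a1_bij e1]] := u1 _ _ ii1 ij1.
have [a2 [a2M a2_bij e2]] := u2 _ _ ii2 ij2.
apply: isomorphic_trans isoH _; apply: isomorphic_trans (isomorphic_sym isoH').
exact: (isomorphic_amalgam a1M a1_bij e1 a2M a2_bij e2).
Qed.

(** * Cyclic groups *)

Lemma morphism_setTM (F G : finGroupType) (i : {morphism [set: F] >-> G}) :
  {morph i : x y / x * y}.
Proof. by move=> x y; rewrite morphM ?inE. Qed.

Lemma injm_inj (F G : finGroupType) (i : {morphism [set: F] >-> G}) :
  'injm i -> injective i.
Proof. by move=> /injmP inj_i x y; apply: inj_i; rewrite inE. Qed.

(** The quotient by a subgroup of index 2 has order 2, so it kills squares. *)
Lemma index2_sqr (G : finGroupType) (K : {group G}) (x : G) :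
  #|[set: G] : K| = 2%N -> x ^+ 2 \in K.
Proof.
move=> index2; have /andP[_ nK] := index2_normal (subsetT K) index2.
have Nx : x \in 'N(K) by rewrite (subsetP nK) ?inE.
apply: coset_idr; first by rewrite groupX.
rewrite morphX //; apply/eqP; rewrite -order_dvdn -index2.
by rewrite -card_quotient // order_dvdG // mem_quotient.
Qed.

Lemma cyclic_hom_ext (F : finGroupType) (H : groupType) (z : F) (f g : F -> H) :
    <[z]> = [set: F] ->
    {morph f : x y / x * y} -> {morph g : x y / x * y} ->
  f z = g z -> f =1 g.
Proof.
move=> Fz fM gM fg x; have /cycleP[k ->] : x \in <[z]> by rewrite Fz inE.
by rewrite (homX fM) (homX gM) fg.
Qed.

(** Both u and r^2 generate the subgroup of order q of <[r]>, so u = r^(2k) with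
    k prime to q. As only the class of k modulo q matters, k can be chosen odd,
    hence prime to 2q, and then r^k is the required generator. *)
Lemma cycle_sqrt (gT : finGroupType) (r u : gT) q :
    (0 < q)%N -> #[r] = (2 * q)%N -> u \in <[r]> -> #[u] = q ->
  exists2 r', <[r']> = <[r]> & r' ^+ 2 = u.
Proof.
move=> q_gt0 or ru ou.
have or2 : #[r ^+ 2] = q by rewrite orderXdiv or ?dvdn_mulr // mulKn.
have /eqP eq_u : <[r ^+ 2]> == <[u]>.
  rewrite (eq_subG_cyclic (cycle_cyclic r)) ?cycle_subG ?mem_cycle //.
  by rewrite -!orderE or2 ou.
have /cycleP[k def_u] : u \in <[r ^+ 2]> by rewrite eq_u cycle_id.
have co_qk : coprime q k.
  by rewrite -or2 -generator_coprime /generator -def_u eq_u.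
(* If k is even then q is odd, being prime to k, so k + q is odd. *)
pose k' := if odd k then k else (k + q)%N.
have odd_k' : odd k'.
  rewrite /k'; case: ifPn => // even_k; rewrite oddD (negPf even_k) /=.
  apply: contraLR co_qk => even_q.
  have: 2 %| gcdn q k by rewrite dvdn_gcd !dvdn2 even_q.
  by apply: contraL => /eqP ->.
have co_k' : coprime q k'.
  by rewrite /k'; case: ifP => // _; rewrite /coprime gcdnDr.
exists (r ^+ k').
  apply/esym/eqP; rewrite -[_ == _]/(generator _ _) generator_coprime or.
  by rewrite coprimeMl coprime2n odd_k'.
rewrite -expgM mulnC expgM def_u /k'; case: ifP => // _.
by rewrite expgD -[in X in _ * X]or2 expg_order mulg1.
Qed.

(** The images of a generator of F have square roots that generate G; the
    automorphism of G carrying one root to the other carries one embedding to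
    the other. *)
Lemma cyclic_unique_embedding (F G : finGroupType) q :
    (0 < q)%N -> cyclic [set: F] -> cyclic [set: G] ->
    #|[set: F]| = q -> #|[set: G]| = (2 * q)%N ->
  unique_embedding F G.
Proof.
move=> q_gt0 /cyclicP[z Fz] /cyclicP[r Gr] oF oG i j [inj_i _] [inj_j _].
have oz : #[z] = q by rewrite orderE -Fz.
have or : #[r] = (2 * q)%N by rewrite orderE -Gr.
have root (l : {morphism [set: F] >-> G}) : 'injm l ->
    exists2 r', <[r']> = <[r]> & r' ^+ 2 = l z.
  move=> inj_l; apply: (cycle_sqrt q_gt0 or); first by rewrite -Gr inE.
  by rewrite order_injm ?inE.
have [r1 Gr1 r1z] := root i inj_i; have [r2 Gr2 r2z] := root j inj_j.
have dv21 : #[r2] %| #[r1] by rewrite !orderE Gr1 Gr2.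
have eM : {morph eltm dv21 : x y / x * y}.
  by move=> x y; rewrite morphM //= Gr1 -Gr inE.
exists (eltm dv21); split=> //.
- apply: injF_bij => x y; have /injmP : 'injm (eltm dv21).
    by rewrite injm_eltm !orderE Gr1 Gr2.
  by apply; rewrite /= Gr1 -Gr inE.
- apply: (cyclic_hom_ext (esym Fz)).
  + by move=> x y; rewrite /= morphism_setTM eM.
  + exact: morphism_setTM.
  + by rewrite /= -r1z (homX eM) eltm_id.
Qed.

Lemma cyclic_cyclic_group m : (0 < m)%N ->
  cyclic [set: cyclic_group m] /\ #|[set: cyclic_group m]| = m.
Proof.
move=> m_gt0; split; last by rewrite cardsT card_ord prednK.
by apply/cyclicP; exists Zp1; apply: Zp_cycle.
Qed.

(** * Dihedral groups *)

(** The defining relations of the dihedral group of order 2q, for a rotation r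
    and a reflection s of any group H, finite or not. *)
Definition dihedral_pair (H : groupType) (q : nat) (r s : H) :=
  [/\ r ^+ q = 1, s ^+ 2 = 1 & s * r = r^-1 * s].

(** A group generated by a dihedral pair is only a quotient of the dihedral
    group of order 2q; the exact orders make G that group itself. *)
Definition dihedral_basis (G : finGroupType) (q : nat) (r s : G) :=
  [/\ #[r] = q, dihedral_pair q r s, s \notin <[r]> &
      #|[set: G]| = (2 * q)%N].

(** Conjugation by s^d is written as the power (q-1)^d, which avoids negative
    exponents and case analysis on d. The exponents on the right depend on q
    only, and not on H: this is what makes the map of [dihedral_extend]
    multiplicative. *)
Lemma dihedral_pair_mul (H : groupType) q (r s : H) i d j e :
    (0 < q)%N -> dihedral_pair q r s ->
  (r ^+ i * s ^+ d) * (r ^+ j * s ^+ e) =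
    r ^+ (i + j * q.-1 ^ d) * s ^+ (d + e).
Proof.
move=> q_gt0 [rq s2 sr].
have srX k : s * r ^+ k = r ^+ (k * q.-1) * s.
  have -> : r ^+ (k * q.-1) = r^-1 ^+ k.
    rewrite mulnC expgM; congr (_ ^+ k); apply: (@mulgI _ r).
    by rewrite -expgS prednK // rq mulgV.
  elim: k => [|k IHk]; first by rewrite !expg0 mulg1 mul1g.
  by rewrite !expgS mulgA sr -mulgA IHk mulgA.
have sdr : s ^+ d * r ^+ j = r ^+ (j * q.-1 ^ d) * s ^+ d.
  elim: d => [|d IHd]; first by rewrite !expg0 mulg1 mul1g muln1.
  by rewrite !expgS -mulgA IHd mulgA srX -mulgA expnSr mulnA.
by rewrite !expgD -!mulgA; congr (_ * _); rewrite mulgA sdr -mulgA.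
Qed.

Lemma dihedral_pair_hom (G H : groupType) (f : G -> H) q r s :
    {morph f : x y / x * y} -> dihedral_pair q r s ->
  dihedral_pair q (f r) (f s).
Proof.
move=> fM [rq s2 sr].
by split; rewrite -?(homX fM) ?rq ?s2 ?(hom1 fM) // -(homV fM) -!fM sr.
Qed.

Section DihedralBasis.
Variables (G : finGroupType) (q : nat) (r s : G).
Hypothesis basis : dihedral_basis q r s.

Let or : #[r] = q. Proof. by case: basis. Qed.
Let q_gt0 : (0 < q)%N. Proof. by rewrite -or order_gt0. Qed.
Let pairG : dihedral_pair q r s. Proof. by case: basis. Qed.
Let s_notin : s \notin <[r]>. Proof. by case: basis. Qed.
Let oG : #|[set: G]| = (2 * q)%N. Proof. by case: basis. Qed.

Lemma dihedral_index2 : #|[set: G] : <[r]>| = 2%N.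
Proof. by rewrite -divgS ?subsetT // oG -orderE or mulnK. Qed.

Lemma dihedral_mulVr x : x \notin <[r]> -> x * s^-1 \in <[r]>.
Proof.
move=> xr; have xU : x \in [set: G] :\: <[r]> by rewrite !inE xr.
have sU : s \in [set: G] :\: <[r]> by rewrite !inE s_notin.
have := rcoset_index2 (subsetT <[r]>) dihedral_index2 sU.
by move=> E; rewrite -E mem_rcoset in xU.
Qed.

Lemma dihedral_decomp x : exists p : nat * nat, x = r ^+ p.1 * s ^+ p.2.
Proof.
case: (boolP (x \in <[r]>)) => [/cycleP[k ->]|/dihedral_mulVr/cycleP[k xk]].
  by exists (k, 0%N); rewrite /= mulg1.
by exists (k, 1%N); rewrite /= expg1 -xk mulgVK.
Qed.

(** In G the exponent of r is determined modulo q and that of s modulo 2, and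
    the relations make R^i * S^d depend on these classes only. *)
Lemma dihedral_decomp_eq (H : groupType) (R S : H) i d j e :
    dihedral_pair q R S ->
  r ^+ i * s ^+ d = r ^+ j * s ^+ e -> R ^+ i * S ^+ d = R ^+ j * S ^+ e.
Proof.
have sq k : s ^+ k = s ^+ (odd k).
  have [_ s2 _] := pairG.
  by rewrite -{1}[k]odd_double_half expgD -mul2n expgM s2 expg1n mulg1.
case=> Rq S2 _; have Sq k : S ^+ k = S ^+ (odd k).
  by rewrite -{1}[k]odd_double_half expgD -mul2n expgM S2 expg1n mulg1.
have RX k l : r ^+ k = r ^+ l -> R ^+ k = R ^+ l.
  move=> /eqP; rewrite eq_expg_mod_order or => /eqP kl.
  have Rm t : R ^+ t = R ^+ (t %% q).
    by rewrite {1}(divn_eq t q) expgD mulnC expgM Rq expg1n mul1g.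
  by rewrite Rm kl -Rm.
rewrite (sq d) (sq e) (Sq d) (Sq e).
have absurd k l : r ^+ k * s = r ^+ l -> False.
  move=> E; have := s_notin; rewrite -(mulKg (r ^+ k) s) E.
  by rewrite groupM ?groupV ?mem_cycle.
case: (odd d) (odd e) => [] [] E.
- by rewrite (RX i j) //; apply: mulIg E.
- by move: E; rewrite expg1 expg0 mulg1 => /absurd.
- by move: E; rewrite expg1 expg0 mulg1 => /esym/absurd.
- by move: E; rewrite !mulg1 => /RX.
Qed.

Lemma dihedral_hom_ext (H : groupType) (f g : G -> H) :
    {morph f : x y / x * y} -> {morph g : x y / x * y} ->
  f r = g r -> f s = g s -> f =1 g.
Proof.
move=> fM gM fgr fgs x; have [p ->] := dihedral_decomp x.
by rewrite fM gM !(homX fM) !(homX gM) fgr fgs.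
Qed.

(** The universal property of the dihedral group for targets that need not be
    finite, such as amalgams. *)
Lemma dihedral_extend (H : groupType) (R S : H) : dihedral_pair q R S ->
  exists f : G -> H, [/\ {morph f : x y / x * y}, f r = R & f s = S].
Proof.
move=> pairH; have [p pE] := choice dihedral_decomp.
pose f x := R ^+ (p x).1 * S ^+ (p x).2.
have fE i d : f (r ^+ i * s ^+ d) = R ^+ i * S ^+ d.
  by apply: dihedral_decomp_eq => //; rewrite -pE.
exists f; split.
- move=> x y; rewrite {1}(pE x) {1}(pE y).
  rewrite (dihedral_pair_mul _ _ _ _ _ pairG) //.
  by rewrite fE (dihedral_pair_mul _ _ _ _ _ pairH).
- by have := fE 1%N 0%N; rewrite !mulg1.
- by have := fE 0%N 1%N; rewrite !mul1g.
Qed.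

Lemma dihedral_reflection x : x \notin <[r]> -> x ^+ 2 = 1 /\ x * r = r^-1 * x.
Proof.
move=> /dihedral_mulVr/cycleP[k xk]; have {xk}-> : x = r ^+ k * s.
  by rewrite -xk mulgVK.
have [rq s2 sr] := pairG; split.
  rewrite expg2 -[in LHS](expg1 s) (dihedral_pair_mul _ _ _ _ _ pairG) // s2.
  rewrite mulg1 expn1 -[X in (X + _)%N]muln1 -mulnDr add1n prednK // mulnC.
  by rewrite expgM rq expg1n.
rewrite -mulgA sr !mulgA; congr (_ * _).
exact/commute_sym/commuteX/commute_sym/commuteV.
Qed.

(** Reflections have order 2. *)
Lemma dihedral_rotation x : (2 < #[x])%N -> x \in <[r]>.
Proof.
apply: contraLR => /dihedral_reflection[x2 _].
by rewrite -leqNgt dvdn_leq // order_dvdn x2.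
Qed.

Lemma dihedral_basis_change r' s' :
  <[r']> = <[r]> -> s' \notin <[r]> -> dihedral_basis q r' s'.
Proof.
move=> r'r s'r; have [s2 sr] := dihedral_reflection s'r.
have or' : #[r'] = q by rewrite orderE r'r -orderE.
split; rewrite ?r'r //; split=> //; first by rewrite -or' expg_order.
have /cycleP[k ->] : r' \in <[r]> by rewrite -r'r cycle_id.
elim: k => [|k IHk]; first by rewrite expg0 invg1 mulg1 mul1g.
by rewrite expgSr mulgA IHk -mulgA sr !mulgA invgM -!expVgn -expgSr -expgS.
Qed.

End DihedralBasis.

(** By the universal property each basis maps to the other, and the two
    homomorphisms are mutually inverse because they are so on the bases. *)
Lemma dihedral_automorphism (G : finGroupType) q (r s r' s' : G) :
    dihedral_basis q r s -> dihedral_basis q r' s' ->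
  exists a : G -> G,
    [/\ {morph a : x y / x * y}, bijective a, a r = r' & a s = s'].
Proof.
move=> b b'; have [_ p _ _] := b; have [_ p' _ _] := b'.
have [f [fM fr fs]] := dihedral_extend b p'.
have [g [gM gr gs]] := dihedral_extend b' p.
exists f; split=> //; exists g => x.
  apply: (dihedral_hom_ext b (f := g \o f) (g := id)); rewrite //= ?fr ?fs //.
  by move=> y z; rewrite /= fM gM.
apply: (dihedral_hom_ext b' (f := f \o g) (g := id)); rewrite //= ?gr ?gs //.
by move=> y z; rewrite /= gM fM.
Qed.

(** The presentation gives a generating pair with #[r] <= q and #[s] <= 2. As
    the group has order 2q, both bounds are attained and <[r]> meets <[s]>
    trivially. *)
Lemma dihedral_group_basis q : (1 < q)%N ->
  exists r s : dihedral_group (2 * q), dihedral_basis q r s.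
Proof.
move=> q_gt1; have oD : #|[set: dihedral_group (2 * q)]| = (2 * q)%N.
  by rewrite mul2n; apply: card_dihedral.
have /existsP[[r s]] : [set: dihedral_group (2 * q)] \homg
    Grp (x : y : x ^+ q, y ^+ 2, x ^ y = x^-1).
  rewrite mul2n; have := Grp_dihedral q_gt1 [set: 'D_(q.*2)]%G.
  by move=> <-; apply: homg_refl.
rewrite /= !xpair_eqE => /andP[/eqP defD /and3P[/eqP rq /eqP s2 /eqP rs]].
have sV : s^-1 = s by apply/eqP; rewrite eq_invg_mul -expg2 s2.
have sr : s * r = r^-1 * s by rewrite -rs conjgE sV -!mulgA -expg2 s2 mulg1.
have Nrs : <[s]> \subset 'N(<[r]>).
  by rewrite norms_cycle rs groupV cycle_id.
have oD' : #|<[r]> * <[s]>| = (2 * q)%N.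
  by rewrite -norm_joinEr // defD.
have oMI := mul_cardG <[r]> <[s]>; rewrite oD' -!orderE in oMI.
have or_le : (#[r] <= q)%N by rewrite dvdn_leq ?(ltnW q_gt1) // order_dvdn rq.
have os_le : (#[s] <= 2)%N by rewrite dvdn_leq // order_dvdn s2.
have I_gt0 : (0 < #|<[r]> :&: <[s]>|)%N by rewrite cardG_gt0.
have q_gt0 := ltnW q_gt1.
have rs_ge : (2 * q <= #[r] * #[s])%N by rewrite oMI leq_pmulr.
have or : #[r] = q.
  apply/eqP; rewrite eqn_leq or_le -(leq_pmul2l (isT : 0 < 2)%N).
  by rewrite (leq_trans rs_ge) // mulnC leq_mul2r os_le orbT.
have os : #[s] = 2.
  apply/eqP; rewrite eqn_leq os_le -(leq_pmul2r q_gt0).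
  by rewrite (leq_trans rs_ge) // or mulnC.
have I1 : #|<[r]> :&: <[s]>| = 1%N.
  move/eqP: oMI; rewrite or os (mulnC q) -{1}[(2 * q)%N]muln1.
  by rewrite eqn_pmul2l ?muln_gt0 // => /eqP <-.
exists r, s; split=> //; apply/negP => sr_in.
have : s \in <[r]> :&: <[s]> by rewrite inE sr_in cycle_id.
rewrite (card1_trivg I1) inE => /eqP s1.
by move: os; rewrite s1 order1.
Qed.

(** * Embeddings in dihedral groups *)

(** If u is a rotation, it generates all rotations and s' = s will do. A
    reflection has order 2, so otherwise q = 2, the group is a Klein
    four-group, and the roles of rotation and reflection can be exchanged. *)
Lemma cyclic_in_dihedral (G : finGroupType) q (r s u : G) :
    (1 < q)%N -> dihedral_basis q r s -> #[u] = q ->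
  exists s', dihedral_basis q u s'.
Proof.
move=> q_gt1 b ou; have [or [_ s2 _] sr oG] := b.
have [ur|ur] := boolP (u \in <[r]>).
  exists s; apply: (dihedral_basis_change b) => //.
  by apply/eqP; rewrite eqEcard cycle_subG ur -!orderE or ou leqnn.
have [u2 uru] := dihedral_reflection b ur.
have q2 : q = 2.
  by apply/eqP; rewrite eqn_leq q_gt1 andbT -ou dvdn_leq // order_dvdn u2.
have uV : u^-1 = u by apply/eqP; rewrite eq_invg_mul -expg2 u2.
have r2 : r ^+ 2 = 1 by rewrite -q2 -or expg_order.
have rV : r^-1 = r by apply/eqP; rewrite eq_invg_mul -expg2 r2.
exists r; split=> //.
  by split; rewrite // ?q2 // uV uru rV.
rewrite cycle2g ?ou // !inE -order_eq1 or negb_or neq_ltn q_gt1 orbT /=.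
by apply: contraNneq ur => <-; apply: cycle_id.
Qed.

Lemma cyclic_dihedral_unique_embedding (F G : finGroupType) q (r s : G) :
    (1 < q)%N -> cyclic [set: F] -> #|[set: F]| = q ->
  dihedral_basis q r s -> unique_embedding F G.
Proof.
move=> q_gt1 /cyclicP[z Fz] oF b i j [inj_i _] [inj_j _].
have oz : #[z] = q by rewrite orderE -Fz.
have [|s1 b1] := cyclic_in_dihedral (u := i z) q_gt1 b.
  by rewrite order_injm ?inE.
have [|s2 b2] := cyclic_in_dihedral (u := j z) q_gt1 b.
  by rewrite order_injm ?inE.
have [a [aM a_bij az _]] := dihedral_automorphism b1 b2.
exists a; split=> //; apply: (cyclic_hom_ext (esym Fz)) => //.
  by move=> x y; rewrite /= morphism_setTM aM.
exact: morphism_setTM.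
Qed.

(** The image of t has order p > 2, so it is a rotation and has a square root r'
    generating the rotations. The image of w inverts that of t, so it is not a
    rotation: it would commute with it and t would have order at most 2. Hence
    r' and the image of w form a basis of G, and it determines the embedding. *)
Lemma dihedral_unique_embedding (F G : finGroupType) p (t w : F) (r s : G) :
    (2 < p)%N -> dihedral_basis p t w -> dihedral_basis (2 * p) r s ->
  unique_embedding F G.
Proof.
move=> p_gt2 bF bG i j [inj_i _] [inj_j _].
have p_gt0 : (0 < p)%N by apply: leq_trans p_gt2.
have [ot [_ _ wt] _ _] := bF; have [or _ _ _] := bG.
have root (l : {morphism [set: F] >-> G}) : 'injm l ->
    exists2 r', dihedral_basis (2 * p) r' (l w) & r' ^+ 2 = l t.
  move=> inj_l; have lM := morphism_setTM l.
  have olt : #[l t] = p by rewrite order_injm ?inE.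
  have ltr : l t \in <[r]> by rewrite (dihedral_rotation bG) // olt.
  have [r' r'r r't] := cycle_sqrt p_gt0 or ltr olt.
  exists r' => //; apply: (dihedral_basis_change bG) => //.
  apply: contraL p_gt2 => lwr; rewrite -leqNgt -olt dvdn_leq // order_dvdn.
  have := congr1 l wt; rewrite !lM (homV lM).
  have /centsP/(_ _ lwr _ ltr) -> := cycle_abelian r.
  by move=> /mulIg; rewrite expg2 => {1}->; rewrite mulVg.
have [r1 b1 r1t] := root i inj_i; have [r2 b2 r2t] := root j inj_j.
have [a [aM a_bij ar as_]] := dihedral_automorphism b1 b2.
exists a; split=> //; apply: (dihedral_hom_ext bF) => //.
- by move=> x y; rewrite /= morphism_setTM aM.
- exact: morphism_setTM.
- by rewrite /= -r1t (homX aM) ar.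
Qed.

(** * Embeddings of the Klein four-group in the dihedral group of order 8 *)

Section KleinInDihedral8.
Variables (F : finGroupType) (t0 w0 : F).
Hypothesis bF : dihedral_basis 2 t0 w0.

Lemma klein_sqr (x : F) : x ^+ 2 = 1.
Proof.
have [ot [t2 _ _] _ _] := bF.
have [/cycleP[k ->]|/(dihedral_reflection bF)[]//] := boolP (x \in <[t0]>).
by rewrite -expgM mulnC expgM t2 expg1n.
Qed.

(** Any two distinct involutions of a Klein four-group may serve as a basis. *)
Lemma klein_basis (z t : F) :
  z != 1 -> t != 1 -> t != z -> dihedral_basis 2 z t.
Proof.
move=> z1 t1 tz; have [_ _ _ oF] := bF.
have oz : #[z] = 2.
  by apply: nt_prime_order => //; apply: klein_sqr.
split=> //; last by rewrite cycle2g // !inE negb_or t1.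
split; rewrite ?klein_sqr // (exponent2_commute klein_sqr).
by congr (_ * _); apply/esym/eqP; rewrite eq_invg_mul -expg2 klein_sqr.
Qed.

Lemma klein_neq (z : F) : exists2 t : F, t != 1 & t != z.
Proof.
have [_ _ _ oF] := bF.
have lt : (#|[set 1%g; z]| < #|[set: F]|)%N.
  by rewrite oF cards2; case: (_ != _).
have /subsetPn[t _] : ~~ ([set: F] \subset [set 1; z]).
  by apply/negP => /subset_leq_card; rewrite leqNgt lt.
by rewrite !inE negb_or => /andP[t1 tz]; exists t.
Qed.

Variables (G : finGroupType) (r s : G) (i : {morphism [set: F] >-> G}).
Hypotheses (bG : dihedral_basis 4 r s) (emb_i : index2_embedding i).

(** The involution z that goes to the central rotation r^2 determines the
    embedding up to an automorphism of G: the image of any other involution is a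
    reflection, and it forms a basis of G with r. Such a z exists because an
    index 2 subgroup contains all squares. *)
Lemma klein_embedding : exists2 z : F, z != 1 & i z = r ^+ 2 /\
  forall t, t != 1 -> t != z -> dihedral_basis 4 r (i t).
Proof.
have [inj_i index2] := emb_i; have iM := morphism_setTM i.
have or : #[r] = 4 by case: bG.
have r4 : r ^+ 2 ^+ 2 = 1 by rewrite -expgM -[X in r ^+ X]or expg_order.
have /morphimP[z _ _ /esym iz] := index2_sqr r index2.
have r2_neq1 : r ^+ 2 != 1 by rewrite -order_dvdn or.
exists z; first by apply: contraNneq r2_neq1 => z1; rewrite -iz z1 (hom1 iM).
split=> // t t1 tz; apply: (dihedral_basis_change bG) => //.
apply/cycleP => -[k itk].
have := hom1 iM; rewrite -(klein_sqr t) (homX iM) itk -expgM => /eqP.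
rewrite -order_dvdn or (@dvdn_pmul2r 2 2 k) // => /dvdnP[m km].
(* A rotation r^k of square 1 has k even, so it is 1 or r^2. *)
have [/eqP|] : i t = 1 \/ i t = i z.
- rewrite itk iz km mulnC expgM -[m]odd_double_half expgD -mul2n !expgM.
  rewrite r4 expg1n mulg1.
  by case: (odd m); [right | left].
- by rewrite -(hom1 iM) (inj_eq (injm_inj inj_i)) (negPf t1).
- by move=> /(injm_inj inj_i) /eqP; rewrite (negPf tz).
Qed.

End KleinInDihedral8.

(** * Embeddings of A4 in S4 *)

(** A transitive action is determined up to isomorphism by the stabilizer of a
    point: h p |-> h p' is a well-defined equivariant bijection when p and p'
    have the same stabilizer in the two actions. *)
Lemma transitive_actions_conjugate (F : finGroupType) (T : finType)
    (i j : F -> {perm T}) (p p' : T) :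
    {morph i : x y / x * y} -> {morph j : x y / x * y} ->
    (forall x, exists h, i h p = x) ->
    (forall h, (i h p == p) = (j h p' == p')) ->
  exists s : {perm T}, forall h, j h = i h ^ s.
Proof.
move=> iM jM trans_i stab; have [c cE] := choice trans_i.
have eq_act h k : (i h p == i k p) = (j h p' == j k p').
  rewrite -(inj_eq (@perm_inj _ (i k^-1)) (i h p)).
  rewrite -(inj_eq (@perm_inj _ (j k^-1)) (j h p')).
  by rewrite -!permM -!iM -!jM mulgV (hom1 iM) (hom1 jM) !perm1 stab.
pose f x := j (c x) p'.
have fE h : f (i h p) = j h p' by apply/eqP; rewrite -eq_act cE.
have f_inj : injective f.
  move=> x y; rewrite -(cE x) -(cE y) !fE => /eqP.
  by rewrite -eq_act => /eqP.
exists (perm f_inj) => h; apply/permP => y.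
rewrite conjgE !permM; set x := ((perm f_inj)^-1 y).
have -> : y = f x by rewrite -[f x](permE f_inj) permKV.
by rewrite permE -(cE x) fE -!permM -iM -jM fE.
Qed.

(** A 3-cycle is a square, namely that of its inverse, so a subgroup of index 2
    contains all 3-cycles. *)
Lemma index2_transitive (K : {group 'S_4}) : #|[set: 'S_4] : K| = 2%N ->
  forall x y, exists2 h, h \in K & h x = y.
Proof.
move=> index2 x y.
have [->|neq_xy] := eqVneq x y; first by exists 1; rewrite ?group1 ?perm1.
have /existsP[k /andP[kx ky]] : [exists k, (k != x) && (k != y)].
  rewrite -[[exists k, _]]negbK negb_exists; apply/negP => /forallP all_xy.
  have : [set: 'I_4] \subset [set x; y].
    by apply/subsetP => k _; have := all_xy k; rewrite negb_and !negbK !inE.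
  by move/subset_leq_card; rewrite cardsT card_ord cards2 neq_xy.
(* The 3-cycle that is squared here maps x to k and k to y. *)
exists ((tperm x y * tperm k y) ^+ 2); first exact: index2_sqr.
have c_x : (tperm x y * tperm k y) x = k by rewrite permM tpermL tpermR.
rewrite expg2 permM c_x.
by rewrite permM (_ : tperm x y k = k) ?tpermL // tpermD // eq_sym.
Qed.

(** Through either embedding A4 acts transitively on the four points, so that
    the point stabilizers have order 12 / 4 = 3. They are Sylow subgroups,
    hence the stabilizer of a point for i is that of a point for j. *)
Lemma Alt4_unique_embedding : unique_embedding A4 Defs.S4.
Proof.
move=> i j emb_i emb_j.
have oA4 : #|[set: A4]| = 12.
  have : (2 * #|'Alt_('I_4)|)%N = 24 by rewrite card_Alt card_ord.
  rewrite -(card_injm (injm_subg 'Alt_('I_4)%G)) // im_subg => o.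
  by apply/eqP; rewrite -(eqn_pmul2l (isT : 0 < 2)%N) o.
pose stab (l : {morphism [set: A4] >-> 'S_4}) (x : 'I_4) :=
  (l @*^-1 'C[x | 'P])%G.
have stabP l x h : (h \in stab l x) = (l h x == x).
  by rewrite !inE sub1set inE.
have transP (l : {morphism [set: A4] >-> 'S_4}) : index2_embedding l ->
    forall x y, exists h, l h x = y.
  move=> [_ index2] x y; have [_ /morphimP[h _ _ ->] <-] :=
    index2_transitive index2 x y.
  by exists h.
have sylow l x : index2_embedding l -> 3.-Sylow([set: A4]) (stab l x).
  move=> emb_l; have [inj_l _] := emb_l.
  have orb : orbit 'P (l @* [set: A4]) x = [set: 'I_4].
    apply/setP => y; rewrite [RHS]inE; apply/orbitP.
    have [h <-] := transP l emb_l x y.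
    by exists (l h); rewrite ?mem_morphim ?inE.
  have := card_orbit_stab 'P (l @* [set: A4]) x.
  rewrite orb cardsT card_ord card_injm ?subsetT // oA4 => o3.
  have eq_stab : l @* stab l x = 'C_(l @* [set: A4])[x | 'P].
    by rewrite -[gval (stab l x)]morphpreIim morphpreK ?subsetIl.
  have {}o3 : #|stab l x| = 3.
    apply/eqP; rewrite -(card_injm inj_l) ?subsetT // eq_stab.
    by rewrite -(eqn_pmul2l (isT : 0 < 4)%N) o3.
  by rewrite pHallE subsetT oA4 o3 p_part.
have [g _ conj_g] := Sylow_trans (sylow i ord0 emb_i) (sylow j ord0 emb_j).
have stab_eq h : (i h (i g ord0) == i g ord0) = (j h ord0 == ord0).
  rewrite -[RHS]stabP conj_g mem_conjg stabP conjgE invgK !morphM ?inE //.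
  by rewrite morphV ?inE // !permM (canF_eq (permKV (i g))).
have [s sE] := transitive_actions_conjugate (morphism_setTM i)
  (morphism_setTM j) (transP i emb_i (i g ord0)) stab_eq.
exists (fun x => x ^ s); split=> [x y||h]; last by rewrite /= sE.
- exact: conjMg.
- by exists (fun x => x ^ s^-1) => x; rewrite ?conjgK ?conjgKV.
Qed.

(** * The groups K1 and K2 *)

(** The amalgam of two dihedral groups of order 8 is presented by their
    generators, the dihedral relations of both factors and the relations
    that identify the images of F. [glued_dihedral8] leaves open the
    form in which the latter are written: relations [glue] will do if they hold
    in the amalgam and if they force the identification on a basis of F. *)
Section GluedDihedral8.
Variables (F G1 G2 : finGroupType).
Variables (i1 : {morphism [set: F] >-> G1}) (i2 : {morphism [set: F] >-> G2}).
Variables (z t : F) (r1 s1 : G1) (r2 s2 : G2).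
Hypotheses (bF : dihedral_basis 2 z t).
Hypotheses (b1 : dihedral_basis 4 r1 s1) (b2 : dihedral_basis 4 r2 s2).

Local Notation A := (amalgam i1 i2).

Definition glued_gen (g : gen4) : A :=
  match g with
  | gen_x => amalgam_inl i1 i2 r1
  | gen_y => amalgam_inl i1 i2 s1
  | gen_a => amalgam_inr i1 i2 r2
  | gen_b => amalgam_inr i1 i2 s2
  end.

Variable glue : seq (word gen4 * word gen4).
Let rels u v := List.In (u, v) (K_common ++ glue).
Local Notation K := (presented rels).

Hypothesis glue_amalgam : forall u v, List.In (u, v) glue ->
  word_eval glued_gen u = word_eval glued_gen v.

Hypothesis glue_presented : forall (f1 : G1 -> K) (f2 : G2 -> K),
  {morph f1 : x y / x * y} -> {morph f2 : x y / x * y} ->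
  f1 r1 = pgen rels gen_x -> f1 s1 = pgen rels gen_y ->
  f2 r2 = pgen rels gen_a -> f2 s2 = pgen rels gen_b ->
  f1 (i1 z) = f2 (i2 z) /\ f1 (i1 t) = f2 (i2 t).

Lemma glued_dihedral8 : isomorphic A K.
Proof.
have inlM := @amalgam_inlM _ _ _ i1 i2; have inrM := @amalgam_inrM _ _ _ i1 i2.
have [_ p1 _ _] := b1; have [_ p2 _ _] := b2.
have [x4 y2 yx] := dihedral_pair_hom inlM p1.
have [a4 B2 ba] := dihedral_pair_hom inrM p2.
have respects u v : rels u v -> word_eval glued_gen u = word_eval glued_gen v.
  case=> [[<- <-]|]; first by rewrite /= mulg1; exact: x4.
  case=> [[<- <-]|]; first by rewrite /= mulg1; exact: y2.
  case=> [[<- <-]|]; first by rewrite /= mulg1; exact: a4.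
  case=> [[<- <-]|]; first by rewrite /= mulg1; exact: B2.
  case=> [[<- <-]|]; first by rewrite /= yx mulgK.
  case=> [[<- <-]|]; first by rewrite /= ba mulgK.
  exact: glue_amalgam.
(* The number of uses of [right] is the position of the relation in the list
   [K_common ++ glue]. *)
have q1 : dihedral_pair 4 (pgen rels gen_x) (pgen rels gen_y).
  split.
  - rewrite -[LHS]/(word_eval (pgen rels) (wgen gen_x) ^+ 4) -word_evalX.
    by apply: (pgen_rel (v := wone)); left.
  - rewrite -[LHS]/(word_eval (pgen rels) (wgen gen_y) ^+ 2) -word_evalX.
    by apply: (pgen_rel (v := wone)); right; left.
  - apply: (canRL (mulgVK _)); apply: (pgen_rel (rel := rels)
      (u := wmul (wmul (wgen gen_y) (wgen gen_x)) (winv (wgen gen_y)))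
      (v := winv (wgen gen_x))).
    by do 4! right; left.
have q2 : dihedral_pair 4 (pgen rels gen_a) (pgen rels gen_b).
  split.
  - rewrite -[LHS]/(word_eval (pgen rels) (wgen gen_a) ^+ 4) -word_evalX.
    by apply: (pgen_rel (v := wone)); right; right; left.
  - rewrite -[LHS]/(word_eval (pgen rels) (wgen gen_b) ^+ 2) -word_evalX.
    by apply: (pgen_rel (v := wone)); right; right; right; left.
  - apply: (canRL (mulgVK _)); apply: (pgen_rel (rel := rels)
      (u := wmul (wmul (wgen gen_b) (wgen gen_a)) (winv (wgen gen_b)))
      (v := winv (wgen gen_a))).
    by do 5! right; left.
have [f1 [f1M f1r f1s]] := dihedral_extend b1 q1.
have [f2 [f2M f2r f2s]] := dihedral_extend b2 q2.
have [glue_z glue_t] := glue_presented f1M f2M f1r f1s f2r f2s.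
have [|f [fM fl fr]] := @amalgam_lift _ _ _ i1 i2 K _ _ f1M f2M.
  apply: (dihedral_hom_ext bF) => //.
  - by move=> x y; rewrite morphism_setTM f1M.
  - by move=> x y; rewrite morphism_setTM f2M.
pose g := presented_lift (rel := rels) glued_gen.
have gM : {morph g : x y / x * y} := presented_liftM respects.
have gE x : g (pgen rels x) = glued_gen x := presented_lift_gen respects x.
apply: (isomorphicI (f := f) (g := g)) => //.
- apply: amalgam_hom_ext => //; first by move=> x y; rewrite /= fM gM.
  + move=> x; rewrite /= fl; move: x; apply: (dihedral_hom_ext b1) => //.
    * by move=> x y; rewrite f1M gM.
    * by rewrite f1r gE.
    * by rewrite f1s gE.
  + move=> x; rewrite /= fr; move: x; apply: (dihedral_hom_ext b2) => //.
    * by move=> x y; rewrite f2M gM.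
    * by rewrite f2r gE.
    * by rewrite f2s gE.
- apply: presented_hom_ext => //; first by move=> x y; rewrite /= gM fM.
  by case; rewrite /= gE /= ?fl ?fr.
Qed.

End GluedDihedral8.

(** Let z1, z2 be the involutions of F that i1, i2 map to the central rotations.
    The rotations x, a are any ones of order 4; the reflections y, b are the
    images of involutions of F chosen so as to match the presentation.
    If z1 = z2, then x^2 = a^2 is the image of z1, and y = b is the image of any
    other involution. If z1 <> z2, then x^2 = b is the image of z1, a^2 is that
    of z2, and y = a^2 b is that of z1 z2. *)
Lemma amalgam_dihedral8 (F G1 G2 : finGroupType) (t0 w0 : F)
    (r1 s1 : G1) (r2 s2 : G2)
    (i1 : {morphism [set: F] >-> G1}) (i2 : {morphism [set: F] >-> G2}) :
    dihedral_basis 2 t0 w0 ->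
    dihedral_basis 4 r1 s1 -> dihedral_basis 4 r2 s2 ->
    index2_embedding i1 -> index2_embedding i2 ->
  isomorphic (amalgam i1 i2) K1 \/ isomorphic (amalgam i1 i2) K2.
Proof.
move=> bF b1 b2 emb1 emb2.
have i1M := morphism_setTM i1; have i2M := morphism_setTM i2.
have [z1 z1n1 [i1z b1']] := klein_embedding bF b1 emb1.
have [z2 z2n1 [i2z b2']] := klein_embedding bF b2 emb2.
have inlM := @amalgam_inlM _ _ _ i1 i2; have inrM := @amalgam_inrM _ _ _ i1 i2.
have [eq_z|neq_z] := eqVneq z1 z2; [left | right].
  rewrite -{z2 z2n1}eq_z in i2z b2' *.
  have [t tn1 tz] := klein_neq bF z1.
  apply: (glued_dihedral8 (klein_basis bF z1n1 tn1 tz) (b1' t tn1 tz)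
    (b2' t tn1 tz)) => [u v|f1 f2 f1M f2M f1r f1s f2r f2s].
    case=> [[<- <-]|[[<- <-]|[]]]; rewrite /=.
      by rewrite !mulg1 -inlM -inrM -!expg2 -i1z -i2z; apply: amalgam_glueE.
    exact: amalgam_glueE.
  rewrite i1z i2z (homX f1M) (homX f2M) f1r f2r f1s f2s; split.
    have := @pgen_rel _ (fun u v => List.In (u, v) K1_rels)
      (wexp (wgen gen_x) 2) (wexp (wgen gen_a) 2).
    by rewrite !word_evalX; apply; do 6! right; left.
  apply: (@pgen_rel _ (fun u v => List.In (u, v) K1_rels)
    (wgen gen_y) (wgen gen_b)).
  by do 7! right; left.
have zC : z1 * z2 = z2 * z1 := exponent2_commute (klein_sqr bF) z1 z2.
have tz : z1 * z2 != z1 by rewrite -[X in _ != X]mulg1 (inj_eq (mulgI z1)).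
have tn1 : z1 * z2 != 1.
  by rewrite -(klein_sqr bF z1) expg2 (inj_eq (mulgI z1)) eq_sym.
apply: (glued_dihedral8 (klein_basis bF z1n1 tn1 tz) (b1' _ tn1 tz)
    (b2' z1 z1n1 neq_z)) => [u v|f1 f2 f1M f2M f1r f1s f2r f2s].
  case=> [[<- <-]|[[<- <-]|[]]]; rewrite /= !mulg1.
    by rewrite -inlM -expg2 -i1z; apply: amalgam_glueE.
  by rewrite amalgam_glueE zC i2M inrM i2z expg2 inrM.
rewrite f1s f2s zC i2M f2M i1z i2z (homX f1M) (homX f2M) f1r f2r f2s; split.
  have := @pgen_rel _ (fun u v => List.In (u, v) K2_rels)
    (wexp (wgen gen_x) 2) (wgen gen_b).
  by rewrite !word_evalX; apply; do 6! right; left.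
rewrite expg2; have := @pgen_rel _ (fun u v => List.In (u, v) K2_rels)
  (wgen gen_y) (wmul (wexp (wgen gen_a) 2) (wgen gen_b)).
by rewrite /= mulg1; apply; do 7! right; left.
Qed.

(** * K1 and K2 are not isomorphic *)

Definition elementary8 : finGroupType := ('I_2 * 'I_2 * 'I_2)%type.

(** The images of x, y, a form a basis and b = y; the relation x^2 = a^2 is
    void as all squares are trivial. *)
Definition K1_gen (g : gen4) : elementary8 :=
  match g with
  | gen_x => (Zp1, Zp0, Zp0)
  | gen_y | gen_b => (Zp0, Zp1, Zp0)
  | gen_a => (Zp0, Zp0, Zp1)
  end.

Lemma elementary8_sqr (t : elementary8) : t ^+ 2 = 1.
Proof.
have I2 (k : 'I_2) : k ^+ 2 = 1.
  by apply/val_inj; case: k => [[|[|]]].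
by case: t => [[i j] k]; rewrite expg2 -[LHS]/(i * i, j * j, k * k) -!expg2 !I2.
Qed.

Lemma elementary8_generated (t : elementary8) : exists w : word gen4,
  t = word_eval K1_gen w.
Proof.
case: t => [[i j] k].
exists (wmul (wmul (wexp (wgen gen_x) i) (wexp (wgen gen_y) j))
          (wexp (wgen gen_a) k)).
apply/eqP.
by case: i => [[|[|]]]; case: j => [[|[|]]]; case: k => [[|[|]]].
Qed.

(** Composing an isomorphism K2 -> K1 with the surjection of K1 onto an
    elementary abelian group of order 8 would give a surjection h from K2. But
    h(b) = h(x)^2 = 1 and h(y) = h(a)^2 h(b) = 1, so the image is generated by
    h(x), h(a), of order at most 2, and has at most 4 elements. *)
Lemma K1_not_K2 : ~ isomorphic K1 K2.
Proof.
move=> [f [g fK gK]].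
have K1_rel u v : List.In (u, v) K1_rels ->
    word_eval K1_gen u = word_eval K1_gen v.
  by move=> uv; apply/eqP; move: uv; do 8! (case=> [[<- <-]|]; first by []).
have liftM := presented_liftM K1_rel.
pose h := presented_lift K1_gen \o g.
have hM : {morph h : x y / x * y}.
  by move=> x y; rewrite /h /= (can2_gmulfM fK gK) liftM.
pose rels2 u v := List.In (u, v) K2_rels.
pose e x := h (pgen rels2 x).
have h_rel u v : rels2 u v -> word_eval e u = word_eval e v.
  move=> uv; rewrite -!(word_eval_hom (rel := rels2) _ hM).
  by congr h; apply: pclass_rel.
have eb : e gen_b = 1.
  rewrite -(elementary8_sqr (e gen_x)) -[e gen_x]/(word_eval e (wgen gen_x)).
  by rewrite -word_evalX; apply/esym/(h_rel _ (wgen gen_b)); do 6! right; left.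
have ey : e gen_y = 1.
  have := h_rel (wgen gen_y) (wmul (wexp (wgen gen_a) 2) (wgen gen_b)).
  rewrite /= mulg1 -expg2 eb elementary8_sqr mulg1; apply.
  by do 7! right; left.
pose L := <[e gen_x]> <*> <[e gen_a]>.
have eL x : e x \in L.
  by case: x; rewrite ?eb ?ey ?group1 // mem_gen // inE cycle_id ?orbT.
have T_L : [set: elementary8] \subset L.
  apply/subsetP => t _; have [w ->] := elementary8_generated t.
  rewrite -(presented_liftE K1_rel) -[pclass _ w]fK.
  move: (f _) => u; rewrite -[presented_lift _ _]/(h u).
  elim/(@pclass_ind _ rels2): u => v.
  by rewrite (word_eval_hom (rel := rels2) _ hM) word_eval_closed.
have o_le (t : elementary8) : (#[t] <= 2)%N.
  by rewrite dvdn_leq // order_dvdn elementary8_sqr.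
have oL : #|L| = #|<[e gen_x]> * <[e gen_a]>|.
  rewrite /L cent_joinEr // cycle_subG; apply/centP => t /cycleP[k ->].
  exact/(exponent2_commute elementary8_sqr).
have := subset_leq_card T_L; rewrite leqNgt oL => /negP; apply.
rewrite cardsT !card_prod !card_ord.
apply: leq_ltn_trans (_ : 2 * 2 < _)%N => //.
apply: leq_trans (leq_mul (o_le (e gen_x)) (o_le (e gen_a))).
by rewrite !orderE mul_cardG leq_pmulr ?cardG_gt0.
Qed.

(** * The amalgam forms *)

Lemma divides_half_gt0 n i q :
  (4 <= n)%N -> (i <= 2)%N -> divides_half q (n - i) -> (0 < q)%N.
Proof.
move=> n_ge4 i_le2 /andP[_]; case: q => // /[!dvd0n] /eqP half0.
have : (2 %/ 2 <= (n - i) %/ 2)%N.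
  apply: leq_div2r; rewrite leq_subRL ?(leq_trans i_le2 (ltnW (ltnW n_ge4))) //.
  exact: leq_trans (leq_add i_le2 (leqnn 2)) n_ge4.
by rewrite half0.
Qed.

Lemma has_form_unique n f (H H' : groupType) : (4 <= n)%N ->
    admissible n f -> f <> DihedralDihedralDihedral 4 ->
  has_form H f -> has_form H' f -> isomorphic H H'.
Proof.
move=> n_ge4; case: f => [q|q|q|q|] /=.
- case=> i i_in half _; have q_gt0 : (0 < q)%N.
    apply: divides_half_gt0 half => //.
    by move: i_in; rewrite !inE => /or3P[]/eqP->.
  have q2_gt0 : (0 < 2 * q)%N by rewrite muln_gt0.
  have [cF oF] := cyclic_cyclic_group q_gt0.
  have [cG oG] := cyclic_cyclic_group q2_gt0.
  by apply: of_form_unique; apply: cyclic_unique_embedding oF oG.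
- case=> q_gt1 _ _; have q_gt0 := ltnW q_gt1.
  have q2_gt0 : (0 < 2 * q)%N by rewrite muln_gt0.
  have [cF oF] := cyclic_cyclic_group q_gt0.
  have [cG oG] := cyclic_cyclic_group q2_gt0.
  have [r [s b]] := dihedral_group_basis q_gt1.
  apply: of_form_unique; first exact: cyclic_unique_embedding oF oG.
  exact: cyclic_dihedral_unique_embedding b.
- case=> q_gt1 _ _; have [cF oF] := cyclic_cyclic_group (ltnW q_gt1).
  have [r [s b]] := dihedral_group_basis q_gt1.
  by apply: of_form_unique; apply: cyclic_dihedral_unique_embedding b.
- case=> q_ge4 even_q _ q_neq4.
  have [p def_q] : exists p, q = (2 * p)%N.
    by exists q./2; rewrite mul2n even_halfK.
  have p_gt2 : (2 < p)%N.
    move: q_ge4; rewrite def_q -{1}[4]/(2 * 2)%N leq_pmul2l // leq_eqVlt.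
    by case/predU1P => // p2; case: q_neq4; rewrite def_q -p2.
  have [t [w bF]] := dihedral_group_basis (ltnW p_gt2).
  have q_gt1 : (1 < 2 * p)%N by rewrite -def_q (leq_trans _ q_ge4).
  have [r [s bG]] := dihedral_group_basis q_gt1.
  rewrite def_q.
  by apply: of_form_unique; apply: dihedral_unique_embedding bF bG.
- by move=> _ _; apply: of_form_unique; apply: Alt4_unique_embedding.
Qed.

Lemma dihedral8_amalgam_K1_or_K2 (H : groupType) :
  has_form H (DihedralDihedralDihedral 4) -> isomorphic H K1 \/ isomorphic H K2.
Proof.
move=> [i1 [i2 [emb1 emb2 isoH]]].
have [t [w bF]] := @dihedral_group_basis 2 isT.
have [r [s bG]] := @dihedral_group_basis 4 isT.
by case: (amalgam_dihedral8 bF bG bG emb1 emb2) => isoK; [left | right];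
   apply: isomorphic_trans isoH isoK.
Qed.

Local Close Scope group_scope.

From mathcomp Require Import all_classical reals topology normedtype.

Local Open Scope classical_set_scope.

Theorem proposition81 (R : realType) (n : nat) (P : set (sphere R))
    (hn4 : (4 <= n)%N) (hneven : ~~ odd n) (hP : (P #= `I_n)%card) :
  (forall (f : amalgam_form), admissible n f ->
     f <> DihedralDihedralDihedral 4 ->
     forall (S1 S2 : {pred mcg P}) (H1 : subGroupType S1) (H2 : subGroupType S2),
       has_form H1 f -> has_form H2 f -> isomorphic H1 H2) /\
  (forall (S : {pred mcg P}) (H : subGroupType S),
     has_form H (DihedralDihedralDihedral 4) ->
     (isomorphic H K1 /\ ~ isomorphic H K2) \/
     (~ isomorphic H K1 /\ isomorphic H K2)).
Proof.
split=> [f adm_f f_neq S1 S2 H1 H2|S H].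
  exact: has_form_unique adm_f f_neq.
case/dihedral8_amalgam_K1_or_K2 => isoK; [left | right]; split=> // isoK'.
  exact: K1_not_K2 (isomorphic_trans (isomorphic_sym isoK) isoK').
exact: K1_not_K2 (isomorphic_trans (isomorphic_sym isoK') isoK).
Qed.
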